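(* Let $\alpha$ be a Perron number of degree $r$ with conjugates $\alpha_1=\alpha,\alpha_2,\dots,\alpha_r$. Given $\sigma_0\in\mathbb{R}$, there are at most a finite number of multi-indices $\kappa\in\mathbb{N}_0^{r-1}$ of length $r-1$ such that $\Re(s_\kappa)=\sigma_0$.
   Context: $\mathbb{N}_0=\{0,1,2,\dots\}$. A Perron number is a real algebraic integer $\alpha>1$ such that all of its other conjugates are strictly smaller than $\alpha$ in modulus. The degree and conjugates are taken over $\mathbb{Q}$. For a multi-index $\kappa=(\kappa_2,\dots,\kappa_r)\in\mathbb{N}_0^{r-1}$ (indexed from $2$ to $r$), put $|\kappa|=\kappa_2+\dots+\kappa_r$ and $$s_\kappa=-|\kappa|+\frac{\log|\alpha_2^{\kappa_2}\cdots\alpha_r^{\kappa_r}|}{\log\alpha}+i\,\frac{\arg(\alpha_2^{\kappa_2}\cdots\alpha_r^{\kappa_r})}{\log\alpha},$$ where $\arg$ is the principal argument with values in $(-\pi,\pi]$. *)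

(* Defs.v *)
From HB Require Import structures.
From mathcomp Require Import all_boot all_order all_algebra.
From mathcomp Require Import all_classical all_reals all_analysis.
From mathcomp Require Import complex.
Set Implicit Arguments.
Unset Strict Implicit.
Unset Printing Implicit Defensive.
Import Order.TTheory GRing.Theory Num.Theory.
Local Open Scope ring_scope.
Local Open Scope complex_scope.

(* The modulus is the real-valued Normc.normc: the generic norm `|z|
   of z : R[i] lives in R[i], not in R. *)
Notation cmod := Normc.normc.

(* p is the monic generator of the ideal of rational polynomials that vanish
   at x; compare minCpolyP for algC. *)
Definition min_polyQ (R : realType) (x : R[i]) (p : {poly rat}) : Prop :=
  p \is monic /\
  forall q : {poly rat}, root (map_poly ratr q) x = (p %| q)%R.

Definition degreeQ (R : realType) (x : R[i]) (r : nat) : Prop :=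
  exists2 p, min_polyQ x p & size p = r.+1.

(* With this definition x is one of its own conjugates. *)
Definition conjugateQ (R : realType) (x z : R[i]) : Prop :=
  exists2 p, min_polyQ x p & root (map_poly ratr p) z.

Definition perron (R : realType) (alpha : R) : Prop :=
  [/\ integralOver (intr : int -> R) alpha,
      1 < alpha &
      forall z : R[i], conjugateQ alpha%:C z -> z != alpha%:C ->
        cmod z < alpha].

(* An enumeration without repetition: over Q the minimal polynomial of an
   algebraic number is separable, so there are as many conjugates as the
   degree. *)
Definition conjugates_of (R : realType) (x : R[i]) (s : seq R[i]) : Prop :=
  uniq s /\ forall z : R[i], z \in s <-> conjugateQ x z.

(* The value at 0 is irrelevant. *)
Definition Arg (R : realType) (z : R[i]) : R :=
  let t := acos (complex.Re z / cmod z) in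
  if 0 <= complex.Im z then t else - t.

Lemma Arg_spec (R : realType) (z : R[i]) : z != 0 ->
  [/\ - pi < Arg z, Arg z <= pi &
      z = (cmod z * cos (Arg z)) +i* (cmod z * sin (Arg z))].
Proof.
case: z => x y z0; rewrite /Arg /=.
set m := Num.sqrt _.
have m2 : m ^+ 2 = x ^+ 2 + y ^+ 2 by rewrite sqr_sqrtr ?addr_ge0 ?sqr_ge0.
have m0 : 0 < m.
  rewrite lt_def sqrtr_ge0 andbT; apply/eqP => m0.
  move: m2; rewrite m0 expr0n /= => /esym/eqP.
  rewrite paddr_eq0 ?sqr_ge0 // !sqrf_eq0 => /andP[/eqP xE /eqP yE].
  by move: z0; rewrite xE yE eqxx.
have xm : `|x| <= m by rewrite -sqrtr_sqr ler_wsqrtr // lerDl sqr_ge0.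
have tB : -1 <= x / m <= 1.
  by rewrite -ler_norml normrM normfV (gtr0_norm m0) ler_pdivrMr // mul1r.
have cE : m * cos (acos (x / m)) = x.
  by rewrite acosK ?in_itv //= mulrC divfK // gt_eqF.
have sE : m * sin (acos (x / m)) = `|y|.
  rewrite sin_acos // -{1}(gtr0_norm m0) -sqrtr_sqr -sqrtrM ?sqr_ge0 //.
  rewrite mulrBr mulr1 exprMn exprVn mulrCA divff ?mulr1; last first.
    by rewrite sqrf_eq0 gt_eqF.
  by rewrite m2 addrAC subrr add0r sqrtr_sqr.
have ge := acos_ge0 tB; have le := acos_lepi tB.
case: ifPn => [y0 | ]; last rewrite -ltNge => y0.
  split => //; first by rewrite (lt_le_trans _ ge) // oppr_lt0 pi_gt0.
  by rewrite cE sE ger0_norm.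
split; last by rewrite cosN sinN cE mulrN sE ltr0_norm // opprK.
- rewrite ltrN2 lt_neqAle le andbT; apply/eqP => E; move: sE.
  by rewrite E sinpi mulr0 => /esym/eqP; rewrite normr_eq0 lt_eqF.
- by rewrite (le_trans _ (pi_ge0 R)) // oppr_le0.
Qed.

(* For r conjugates a = (alpha_1, ..., alpha_r), positions are shifted: a`_j is
   alpha_(j+1) and kappa j is kappa_(j+2), so that j : 'I_r.-1 ranges over the
   indices 2, ..., r. *)
Definition mindex_len (r : nat) (kappa : {ffun 'I_r.-1 -> nat}) : nat :=
  (\sum_(j < r.-1) kappa j)%N.

Definition mindex_pow (R : realType) (r : nat) (a : r.-tuple R[i])
    (kappa : {ffun 'I_r.-1 -> nat}) : R[i] :=
  \prod_(j < r.-1) a`_j.+1 ^+ kappa j.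

Definition s_ (R : realType) (alpha : R) (r : nat) (a : r.-tuple R[i])
    (kappa : {ffun 'I_r.-1 -> nat}) : R[i] :=
  - (mindex_len kappa)%:R
  + (ln (cmod (mindex_pow a kappa)) / ln alpha)%:C
  + 'i * (Arg (mindex_pow a kappa) / ln alpha)%:C.

(* Main.v *)
(* Since [Re s_kappa = - \sum_j kappa_j (1 - ln |alpha_j| / ln alpha)] and the
   Perron condition makes every coefficient [1 - ln |alpha_j| / ln alpha]
   positive, fixing the sum bounds each [kappa_j] separately. *)
Require Import Defs.
From mathcomp Require Import all_boot all_order all_algebra.
From mathcomp Require Import all_classical all_reals all_analysis.
From mathcomp Require Import complex.
Import Order.TTheory GRing.Theory Num.Theory.
Local Open Scope classical_set_scope.
Local Open Scope ring_scope.
Local Open Scope complex_scope.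

Lemma finite_ffun_bounded (I : finType) (N : nat) (A : set {ffun I -> nat}) :
  (forall f, A f -> forall i, (f i <= N)%N) -> finite_set A.
Proof.
(* Bounded functions come from the finite type [{ffun I -> 'I_N.+1}] by forgetting the bound. *)
move=> AN; apply: (@sub_finite_set _ _
  ((fun g : {ffun I -> 'I_N.+1} => [ffun i => g i : nat]) @` setT)).
  move=> f /AN fN; exists [ffun i => inord (f i)] => //.
  by apply/ffunP => i; rewrite !ffunE inordK // ltnS.
exact/finite_image/finite_finset.
Qed.

Lemma finite_ffun_weight (R : archiRealFieldType) (I : finType) (c : I -> R)
    (s : R) : (forall i, 0 < c i) ->
  finite_set [set f : {ffun I -> nat} | \sum_i (f i)%:R * c i = s].
Proof.
(* Each [f i] is at most [s / c i]; the maximum over [i] makes the bound uniform. *)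
move=> c0; apply: (@finite_ffun_bounded _ (\max_i Num.bound (s / c i))).
move=> f /= fs i; apply: leq_trans (leq_bigmax i).
have fi : (f i)%:R <= s / c i.
  rewrite ler_pdivlMr // -fs (bigD1 i) //= lerDl.
  by rewrite sumr_ge0 // => j _; rewrite mulr_ge0 // ltW.
(* [archi_boundP] needs [0 <= s / c i]; no sign of [s] is assumed, but [0 <= f i <= s / c i]
   supplies it. *)
have := archi_boundP (le_trans (ler0n _ _) fi).
by move=> /(le_lt_trans fi); rewrite ltr_nat => /ltnW.
Qed.

(** A zero conjugate would make ['X] divide the minimal polynomial; the cofactor would still vanish
    at [x != 0], against minimality of the degree. *)
Lemma conjugateQ_neq0 (R : realType) (x z : R[i]) :
  x != 0 -> conjugateQ x z -> z != 0.
Proof.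
move=> x0 [p [mp pP] pz]; apply/eqP => z0.
have p0 : root p 0.
  (* Vanishing at 0 only concerns the constant coefficient, so it descends to [rat] by injectivity
     of [ratr]. *)
  by move: pz; rewrite z0 !rootE !horner_coef0 coef_map fmorph_eq0.
have [q pE] := factor_theorem _ _ p0; rewrite subr0 in pE.
have q0 : q != 0.
  apply: contraTneq mp => q0.
  by rewrite pE q0 mul0r monicE lead_coef0 eq_sym oner_eq0.
have : root (map_poly ratr p) x by rewrite pP dvdpp.
rewrite pE rmorphM /= map_polyX rootM rootX (negPf x0) orbF pP.
by move=> /(dvdp_leq q0); rewrite pE size_mulX // ltnn.
Qed.

Lemma normc_prod (R : rcfType) (I : Type) (s : seq I) (F : I -> R[i]) :
  cmod (\prod_(i <- s) F i) = \prod_(i <- s) cmod (F i).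
Proof.
by apply: (big_morph _ (@Normc.normcM R)); rewrite Normc.normc1.
Qed.

Lemma normc_exp (R : rcfType) (z : R[i]) n : cmod (z ^+ n) = cmod z ^+ n.
Proof.
elim: n => [|n IHn]; first by rewrite !expr0 Normc.normc1.
by rewrite !exprS Normc.normcM IHn.
Qed.

Lemma normc_gt0 (R : rcfType) (z : R[i]) : z != 0 -> 0 < cmod z.
Proof.
move=> z0; rewrite lt_def; apply/andP; split; last first.
  by case: z {z0} => x y; exact: sqrtr_ge0.
by apply: contraNneq z0 => /Normc.eq0_normc ->.
Qed.

Lemma ln_prod (R : realType) (I : finType) (F : I -> R) :
  (forall i, 0 < F i) -> ln (\prod_i F i) = \sum_i ln (F i).
Proof.
move=> F0.
(* Positivity is carried through the induction because [lnM] needs it of both partial products. *)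
pose P (u v : R) := 0 < u /\ ln u = v.
suff [] : P (\prod_i F i) (\sum_i ln (F i)) by [].
apply: (big_ind2 P) => [|u v u' v' [u0 <-] [u0' <-]|i _].
- by split; rewrite ?ln1.
- by split; rewrite ?mulr_gt0 // lnM.
- by split.
Qed.

(* The conjugates must be nonzero: ln 0 = 0, so ln of a product splits only for
   positive factors. *)
Lemma Re_s_ (R : realType) (alpha : R) (r : nat) (a : r.-tuple R[i])
    (kappa : {ffun 'I_r.-1 -> nat}) :
  (forall j : 'I_r.-1, a`_j.+1 != 0) ->
  complex.Re (s_ alpha a kappa) =
  - \sum_j (kappa j)%:R * (1 - ln (cmod a`_j.+1) / ln alpha).
Proof.
move=> a0; have -> : complex.Re (s_ alpha a kappa) =
  - (mindex_len kappa)%:R + ln (cmod (mindex_pow a kappa)) / ln alpha.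
  (* The [Arg] term is purely imaginary and drops out. *)
  rewrite /s_ !raddfD raddfN /= mul0r mulr0 subr0 addr0; congr (- _ + _).
  by rewrite -(rmorph_nat (real_complex R)).
have a_gt0 (j : 'I_r.-1) : 0 < cmod a`_j.+1 ^+ kappa j.
  by rewrite exprn_gt0 ?normc_gt0.
rewrite /mindex_pow normc_prod.
under eq_bigr do rewrite normc_exp.
rewrite ln_prod // /mindex_len natr_sum mulr_suml -!sumrN -big_split /=.
apply: eq_bigr => j _.
by rewrite lnXn ?normc_gt0 // mulrBr mulr1 opprB addrC -[_ *+ _]mulr_natl mulrA.
Qed.

Theorem proposition3p1 (R : realType) (alpha : R) (r : nat)
    (a : r.-tuple R[i]) (sigma0 : R) :
  perron alpha ->
  degreeQ alpha%:C r ->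
  conjugates_of alpha%:C a ->
  a`_0 = alpha%:C ->
  finite_set [set kappa : {ffun 'I_r.-1 -> nat} |
    complex.Re (s_ alpha a kappa) = sigma0].
Proof.
move=> [_ alpha1 dom] _ [ua aP] a_0.
have alpha0 : 0 < alpha by exact: lt_trans alpha1.
have jr (j : 'I_r.-1) : (j.+1 < r)%N by rewrite -ltn_predRL.
have aconj (j : 'I_r.-1) : conjugateQ alpha%:C a`_j.+1.
  by apply/aP; rewrite mem_nth // size_tuple.
have a_neq0 (j : 'I_r.-1) : a`_j.+1 != 0.
  apply: conjugateQ_neq0 (aconj j).
  by rewrite (fmorph_eq0 (real_complex R)) gt_eqF.
have a_lt (j : 'I_r.-1) : cmod a`_j.+1 < alpha.
  apply: dom => //; rewrite -a_0 nth_uniq ?size_tuple //.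
  (* Index 0 must also be in range for [nth_uniq]; any [j : 'I_r.-1] forces [0 < r]. *)
  exact: leq_ltn_trans (jr j).
pose c (j : 'I_r.-1) := 1 - ln (cmod a`_j.+1) / ln alpha.
have c_gt0 j : 0 < c j.
  (* Dividing by [ln alpha] uses [1 < alpha]; strict monotonicity of [ln] uses that the conjugate is
     nonzero. *)
  by rewrite subr_gt0 ltr_pdivrMr ?ln_gt0 // mul1r ltr_ln ?posrE // normc_gt0.
apply: sub_finite_set (finite_ffun_weight _ _ _ (- sigma0) c_gt0).
by move=> kappa /=; rewrite Re_s_ // => <-; rewrite opprK.
Qed.
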